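(* Let $S=\mathcal{D}(\omega)$ be a $3$-dimensional quantum polynomial algebra, where $\omega\in V^{\otimes 3}$ is a regular twisted superpotential, and let $f\in S_2$ be a central regular element. Let $A=S/(f)$ be the noncommutative conic. Then the quadratic dual $A^!$ is commutative if and only if $\omega$ is a symmetric regular superpotential.
   Context: Let $k$ be an algebraically closed field of characteristic zero; all algebras, vector spaces and tensor products are over $k$. A $d$-dimensional quantum polynomial algebra is a noetherian connected graded $k$-algebra $S$ with (1) global dimension $d<\infty$, (2) $\operatorname{Ext}^i_S(k,S)\cong k$ if $i=d$ and $0$ if $i\ne d$, (3) Hilbert series $\sum_n(\dim_k S_n)t^n=(1-t)^{-d}$. For a quadratic algebra $A=T(V)/(R)$ with $V$ finite dimensional and $R\subset V\otimes V$, the quadratic dual is $A^!=T(V^* )/(R^\perp)$, where $R^\perp\subset V^*\otimes V^*$ is the orthogonal complement of $R$. If $S$ is a $3$-dimensional quantum polynomial algebra and $f\in S_2$ is central and regular, $A=S/(f)$ is called a noncommutative conic; it is a quadratic (indeed Koszul) algebra. Let $V$ be a $3$-dimensional vector space with basis $x_1,x_2,x_3$. For $\omega\in V^{\otimes 3}$ (a potential) write uniquely $\omega=\sum_{i=1}^3 x_i\otimes\omega_i$ with $\omega_i\in V^{\otimes 2}$, put $\partial_{x_i}\omega=\omega_i$, and $\mathcal{D}(\omega)=T(V)/(\partial_{x_1}\omega,\partial_{x_2}\omega,\partial_{x_3}\omega)$. Let $\varphi:V^{\otimes 3}\to V^{\otimes 3}$ be the linear map $u_1\otimes u_2\otimes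 u_3\mapsto u_2\otimes u_3\otimes u_1$. The potential $\omega$ is a superpotential if $\varphi(\omega)=\omega$, and a twisted superpotential if $(\sigma\otimes\mathrm{id}\otimes\mathrm{id})\varphi(\omega)=\omega$ for some $\sigma\in \mathrm{GL}(V)$. It is regular if $\mathcal{D}(\omega)$ is a ($3$-dimensional) quantum polynomial algebra. It is symmetric if it is a symmetric tensor, i.e. invariant under the action of the symmetric group of degree $3$ on $V^{\otimes 3}$ permuting the tensor factors. *)

(* Defs.v *)
From HB Require Import structures.
From mathcomp Require Import all_boot all_order all_fingroup all_algebra.
From mathcomp Require Import generic_quotient ring_quotient.
From mathcomp Require Import boolp.
From mathcomp.multinomials Require Import monalg.

Set Implicit Arguments.
Unset Strict Implicit.
Unset Printing Implicit Defensive.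

Import GRing.Theory.
Local Open Scope ring_scope.
Local Open Scope quotient_scope.

(* A k-algebra is a ring with a ring morphism from k to its centre.  This is
   used instead of [algType], which excludes the zero ring: a quotient by an
   arbitrary two-sided ideal may be zero. *)
Record kalgebra (k : fieldType) := KAlgebra {
  kalg_ring :> pzRingType;
  kalg_map : {rmorphism k -> kalg_ring};
  kalg_central : forall a x, kalg_map a * x = x * kalg_map a }.

Arguments kalg_map {k} A : rename.

Section QuotientModule.
Variables (R : pzRingType) (M : lmodType R).

Definition submodule (N : M -> Prop) :=
  N 0 /\ forall (a : R) x y, N x -> N y -> N (a *: x + y).

Variable X : M -> Prop.

Definition gen_submodule : {pred M} := fun x =>
  `[< forall N, submodule N -> (forall y, X y -> N y) -> N x >].

Lemma gen_submoduleP x : reflect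
  (forall N, submodule N -> (forall y, X y -> N y) -> N x)
  (x \in gen_submodule).
Proof. exact: asboolP. Qed.

Fact gen_submodule_closed : submod_closed gen_submodule.
Proof.
split=> [|a x y /gen_submoduleP hx /gen_submoduleP hy].
  by apply/gen_submoduleP => N [].
apply/gen_submoduleP => N hN hX.
by case: (hN) => _; apply; [apply: hx|apply: hy].
Qed.

HB.instance Definition _ :=
  GRing.isSubmodClosed.Build R M gen_submodule gen_submodule_closed.

Definition quot_module := Quotient.quot gen_submodule.

HB.instance Definition _ := GRing.Zmodule.on quot_module.
HB.instance Definition _ := EqQuotient.on quot_module.

Definition module_proj (x : M) : quot_module := \pi_quot_module x.

Lemma module_projP x y :
  reflect (module_proj x = module_proj y) (x - y \in gen_submodule).
Proof. by rewrite (Quotient.idealrBE gen_submodule); exact: eqP. Qed.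

Lemma module_proj_repr q : module_proj (repr q) = q.
Proof. exact: reprK. Qed.

Lemma module_projD x y : module_proj (x + y) = module_proj x + module_proj y.
Proof. exact: (Quotient.pi_add gen_submodule). Qed.

Definition quot_scale (a : R) (q : quot_module) : quot_module :=
  module_proj (a *: repr q).

Fact module_projZ_subproof a x :
  quot_scale a (module_proj x) = module_proj (a *: x).
Proof.
apply/module_projP; rewrite -scalerBr rpredZ //.
by apply/module_projP; rewrite module_proj_repr.
Qed.

Let projE := (module_projZ_subproof, =^~ module_projD).

Fact quot_scaleA a b q : quot_scale a (quot_scale b q) = quot_scale (a * b) q.
Proof. by rewrite -[q]module_proj_repr !projE scalerA. Qed.
Fact quot_scale1 : left_id 1 quot_scale.
Proof. by move=> q; rewrite -[q]module_proj_repr projE scale1r. Qed.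
Fact quot_scaleDr : right_distributive quot_scale +%R.
Proof.
move=> a p q; rewrite -[p]module_proj_repr -[q]module_proj_repr.
by rewrite !projE scalerDr.
Qed.
Fact quot_scaleDl q : {morph quot_scale^~ q : a b / a + b}.
Proof.
by move=> a b; rewrite -[q]module_proj_repr !projE scalerDl.
Qed.

HB.instance Definition _ := GRing.Zmodule_isLmodule.Build R quot_module
  quot_scaleA quot_scale1 quot_scaleDr quot_scaleDl.

End QuotientModule.

Section QuotientRing.
Variable T : pzRingType.

Definition two_sided_ideal (I : T -> Prop) :=
  [/\ I 0, forall x y, I x -> I y -> I (x - y)
    & forall a x b, I x -> I (a * x * b)].

Variable X : T -> Prop.

Definition gen_ideal : {pred T} := fun x =>
  `[< forall I, two_sided_ideal I -> (forall y, X y -> I y) -> I x >].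

Lemma gen_idealP x : reflect
  (forall I, two_sided_ideal I -> (forall y, X y -> I y) -> I x)
  (x \in gen_ideal).
Proof. exact: asboolP. Qed.

Fact gen_ideal_zmod_closed : zmod_closed gen_ideal.
Proof.
split=> [|x y /gen_idealP hx /gen_idealP hy].
  by apply/gen_idealP => I [].
apply/gen_idealP => I hI hX.
by case: (hI) => _ hB _; apply: hB; [apply: hx|apply: hy].
Qed.

HB.instance Definition _ :=
  GRing.isZmodClosed.Build T gen_ideal gen_ideal_zmod_closed.

Lemma gen_ideal_gen x : X x -> x \in gen_ideal.
Proof. by move=> hx; apply/gen_idealP => I _; apply. Qed.

Lemma gen_idealM a x b : x \in gen_ideal -> a * x * b \in gen_ideal.
Proof.
move=> /gen_idealP hx; apply/gen_idealP => I hI hX.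
by case: (hI) => _ _; apply; apply: hx.
Qed.

Lemma gen_idealMl a x : x \in gen_ideal -> a * x \in gen_ideal.
Proof. by move/(gen_idealM a 1); rewrite mulr1. Qed.

Lemma gen_idealMr a x : x \in gen_ideal -> x * a \in gen_ideal.
Proof. by move/(gen_idealM 1 a); rewrite mul1r. Qed.

Definition quot_ring := Quotient.quot gen_ideal.

HB.instance Definition _ := GRing.Zmodule.on quot_ring.
HB.instance Definition _ := EqQuotient.on quot_ring.

Definition quot_proj (x : T) : quot_ring := \pi_quot_ring x.

Lemma quot_projP x y :
  reflect (quot_proj x = quot_proj y) (x - y \in gen_ideal).
Proof. by rewrite (Quotient.idealrBE gen_ideal); exact: eqP. Qed.

Lemma quot_proj_repr q : quot_proj (repr q) = q.
Proof. exact: reprK. Qed.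

Lemma quot_projD x y : quot_proj (x + y) = quot_proj x + quot_proj y.
Proof. exact: (Quotient.pi_add gen_ideal). Qed.

Definition quot_one : quot_ring := quot_proj 1.
Definition quot_mul (p q : quot_ring) : quot_ring :=
  quot_proj (repr p * repr q).

Fact quot_projM_subproof x y :
  quot_mul (quot_proj x) (quot_proj y) = quot_proj (x * y).
Proof.
apply/quot_projP; set x' := repr _; set y' := repr _.
have -> : x' * y' - x * y = (x' - x) * y' + x * (y' - y).
  by rewrite mulrBl mulrBr addrA subrK.
apply: rpredD; [apply: gen_idealMr|apply: gen_idealMl];
  by apply/quot_projP; rewrite quot_proj_repr.
Qed.

Let projE := (quot_projM_subproof, =^~ quot_projD).

Fact quot_mulA : associative quot_mul.
Proof.
move=> p q r; rewrite -[p]quot_proj_repr -[q]quot_proj_repr -[r]quot_proj_repr.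
by rewrite !projE mulrA.
Qed.
Fact quot_mul1r : left_id quot_one quot_mul.
Proof. by move=> p; rewrite -[p]quot_proj_repr projE mul1r. Qed.
Fact quot_mulr1 : right_id quot_one quot_mul.
Proof. by move=> p; rewrite -[p]quot_proj_repr projE mulr1. Qed.
Fact quot_mulDl : left_distributive quot_mul +%R.
Proof.
move=> p q r; rewrite -[p]quot_proj_repr -[q]quot_proj_repr -[r]quot_proj_repr.
by rewrite !projE mulrDl.
Qed.
Fact quot_mulDr : right_distributive quot_mul +%R.
Proof.
move=> p q r; rewrite -[p]quot_proj_repr -[q]quot_proj_repr -[r]quot_proj_repr.
by rewrite !projE mulrDr.
Qed.

HB.instance Definition _ := GRing.Zmodule_isPzRing.Build quot_ring
  quot_mulA quot_mul1r quot_mulr1 quot_mulDl quot_mulDr.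

Lemma quot_projM x y : quot_proj (x * y) = quot_proj x * quot_proj y.
Proof. by rewrite -quot_projM_subproof. Qed.

Fact quot_proj_is_zmod_morphism : zmod_morphism quot_proj.
Proof.
move=> x y; apply: (addIr (quot_proj y)).
by rewrite subrK -quot_projD subrK.
Qed.
HB.instance Definition _ :=
  GRing.isZmodMorphism.Build T quot_ring quot_proj quot_proj_is_zmod_morphism.

Fact quot_proj_is_monoid_morphism : monoid_morphism quot_proj.
Proof. by split=> // x y; rewrite quot_projM. Qed.
HB.instance Definition _ :=
  GRing.isMonoidMorphism.Build T quot_ring quot_proj
    quot_proj_is_monoid_morphism.

Lemma quot_proj_eq0 x : (quot_proj x = 0) <-> (x \in gen_ideal).
Proof.
rewrite -{2}[x]subr0 -(raddf0 quot_proj); split=> [h|/quot_projP//].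
exact/quot_projP.
Qed.

End QuotientRing.

Section QuotientAlgebra.
Variables (k : fieldType) (A : kalgebra k) (X : A -> Prop).

Definition quot_kalg_map (a : k) : quot_ring X := quot_proj X (kalg_map A a).

HB.instance Definition _ :=
  GRing.RMorphism.copy quot_kalg_map (quot_proj X \o kalg_map A).

Fact quot_kalg_central a x : quot_kalg_map a * x = x * quot_kalg_map a.
Proof.
by rewrite -[x]quot_proj_repr /quot_kalg_map -!quot_projM kalg_central.
Qed.

Definition quot_algebra : kalgebra k := KAlgebra quot_kalg_central.

End QuotientAlgebra.

Section Ext.
Variable S : pzRingType.

Definition projective (P : lmodType S) :=
  forall (M N : lmodType S) (g : {linear M -> N}) (f : {linear P -> N}),
    (forall y, exists x, g x = y) ->
    exists h : {linear P -> M}, forall x, g (h x) = f x.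

Record proj_resolution (M : lmodType S) := ProjResolution {
  res_mod :> nat -> lmodType S;
  res_diff : forall i, {linear res_mod i.+1 -> res_mod i};
  res_aug : {linear res_mod 0 -> M};
  res_proj : forall i, projective (res_mod i);
  res_surj : forall y, exists x, res_aug x = y;
  res_exact0 : forall x, res_aug x = 0 <-> exists y, x = res_diff 0 y;
  res_exact : forall i x,
    res_diff i x = 0 <-> exists y, x = res_diff i.+1 y }.

Definition proj_dim_le (M : lmodType S) (n : nat) :=
  exists P : proj_resolution M, forall i, (n < i)%N -> forall x : P i, x = 0.

Definition global_dim (d : nat) :=
  (forall M : lmodType S, proj_dim_le M d) /\
  (forall e, (forall M : lmodType S, proj_dim_le M e) -> (d <= e)%N).

Definition cocycle (M N : lmodType S) (P : proj_resolution M) i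
    (g : {linear P i -> N}) :=
  forall x, g (res_diff P i x) = 0.

Definition coboundary (M N : lmodType S) (P : proj_resolution M) i :
    {linear P i -> N} -> Prop :=
  match i with
  | 0 => fun g => forall x, g x = 0
  | j.+1 => fun g => exists h : {linear P j -> N},
      forall x, g x = h (res_diff P j x)
  end.

Definition left_ideal (I : S -> Prop) :=
  I 0 /\ forall a x y, I x -> I y -> I (a * x + y).
Definition right_ideal (I : S -> Prop) :=
  I 0 /\ forall a x y, I x -> I y -> I (x * a + y).

Definition ACC (P : (S -> Prop) -> Prop) :=
  forall I : nat -> S -> Prop, (forall n, P (I n)) ->
    (forall n x, I n x -> I n.+1 x) ->
    exists n, forall m, (n <= m)%N -> forall x, I m x -> I n x.

Definition noetherian := ACC left_ideal /\ ACC right_ideal.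

End Ext.

Section QuantumPolynomial.
Variables (k : fieldType) (S : kalgebra k).

(* [Ext_iso M N i E]: Ext^i_S(M, N), computed as the degree i cohomology of
   Hom_S(P, N) for a projective resolution P of M, is k-isomorphic to E; the
   map F induces the isomorphism.  The field acts on N through k -> S. *)
Definition Ext_iso (M N : lmodType S) (i : nat) (E : lmodType k) :=
  exists (P : proj_resolution M) (F : {linear P i -> N} -> E),
  [/\ forall (a : k) (g g' h : {linear P i -> N}), cocycle g -> cocycle g' ->
        (forall x, h x = kalg_map S a *: g x + g' x) -> F h = a *: F g + F g',
      forall e, exists2 g, cocycle g & F g = e
    & forall g, cocycle g -> (F g = 0 <-> coboundary g)].

Definition subspace (W : S -> Prop) :=
  W 0 /\ forall (a : k) x y, W x -> W y -> W (kalg_map S a * x + y).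

Definition has_dim (W : S -> Prop) (m : nat) :=
  exists b : 'I_m -> S, (forall i, W (b i)) /\
    forall x, W x -> exists! c : {ffun 'I_m -> k},
      x = \sum_i kalg_map S (c i) * b i.

Definition connected_graded (G : nat -> S -> Prop) :=
  [/\ forall i, subspace (G i),
      forall i j x y, G i x -> G j y -> G (i + j)%N (x * y),
      forall x, exists n (c : nat -> S),
        (forall i, G i (c i)) /\ x = \sum_(i < n) c i,
      forall n (c : nat -> S), (forall i, G i (c i)) ->
        \sum_(i < n) c i = 0 -> forall i, (i < n)%N -> c i = 0
    & (forall x, G 0%N x <-> exists a : k, x = kalg_map S a) /\ (1 : S) <> 0].

(* The module k = S / S_{>= 1}. *)
Definition trivial_module (G : nat -> S -> Prop) : lmodType S :=
  quot_module (fun x : S^o => exists2 n, (0 < n)%N & G n x).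

(* H(t) * (1 - t)^d = 1, coefficientwise, for the Hilbert series H. *)
Definition hilbert_condition (d : nat) (G : nat -> S -> Prop) :=
  exists2 h : nat -> nat, forall n, has_dim (G n) (h n) &
    forall n, ((\poly_(i < n.+1) (h i)%:Z) * (1 - 'X) ^+ d)`_n
              = (n == 0%N)%:Z.

Definition quantum_polynomial (d : nat) (G : nat -> S -> Prop) :=
  [/\ noetherian S /\ connected_graded G,
      global_dim S d,
      Ext_iso (trivial_module G) S^o d k^o,
      forall i, i <> d -> Ext_iso (trivial_module G) S^o i 'rV[k]_0
    & hilbert_condition d G].

End QuantumPolynomial.

Section Potentials.
Variables (k : fieldType) (n : nat).

(* V has the basis x_i, i : 'I_n.  An element of the m-th tensor power of V is
   given by its coordinates in the basis x_(w 0) (x) ... (x) x_(w (m-1)), and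
   T(V) is the algebra of the free monoid on 'I_n. *)
Definition tensor m := {ffun m.-tuple 'I_n -> k}.

Fact tensor_alg_central (a : k) (x : {malg k[{fmonom 'I_n}]}) :
  a%:MP * x = x * a%:MP.
Proof.
rewrite !malgM_def fgmulUg fgmulgU; apply: eq_bigr => w _.
by rewrite mulrC mul1m mulm1.
Qed.

Definition tensor_alg : kalgebra k := KAlgebra tensor_alg_central.

Definition tens m (t : tensor m) : tensor_alg :=
  \sum_(w : m.-tuple 'I_n) << t w *g FMonom w >>.

Definition pure_tensor m (u : m.-tuple 'rV[k]_n) : tensor m :=
  [ffun w : m.-tuple 'I_n => \prod_(i < m) tnth u i 0 (tnth w i)].

Definition derivative (i : 'I_n) m (t : tensor m.+1) : tensor m :=
  [ffun w : m.-tuple 'I_n => t [tuple of i :: w]].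

Definition cyclic_shift m (t : tensor m) : tensor m :=
  [ffun w : m.-tuple 'I_n => t [tuple of rotr 1 w]].

Lemma cyclic_shift_pure m (u : m.-tuple 'rV[k]_n) :
  cyclic_shift (pure_tensor u) = pure_tensor [tuple of rot 1 u].
Proof.
have rotE (T : eqType) (v : m.-tuple T) i :
    tnth [tuple of rot 1 v] i = tnth v (ordS i).
  case: m v i {u} => [|m] v i; first by case: i.
  case/tupleP: v => x v; rewrite !(tnth_nth x) /= rot1_cons nth_rcons size_tuple.
  have := ltn_ord i; rewrite ltnS leq_eqVlt => /orP[/eqP ->|lt_im].
    by rewrite ltnn eqxx modnn.
  by rewrite lt_im modn_small.
apply/ffunP => w; rewrite !ffunE (reindex_inj (bij_inj (ordS_bij m))) /=.
apply: eq_bigr => i _; rewrite -!rotE; congr (_ 0 _).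
by congr tnth; apply: val_inj; rewrite /= rotrK.
Qed.

Lemma cyclic_shift_pure3 (u1 u2 u3 : 'rV[k]_n) :
  cyclic_shift (pure_tensor [tuple u1; u2; u3]) =
  pure_tensor [tuple u2; u3; u1].
Proof. by rewrite cyclic_shift_pure; congr pure_tensor; apply: val_inj. Qed.

(* (sigma (x) id (x) ... (x) id) t, where sigma x_a = \sum_i sigma a i x_i. *)
Definition twist_first (sigma : 'M[k]_n) m (t : tensor m.+1) : tensor m.+1 :=
  [ffun w : m.+1.-tuple 'I_n =>
    \sum_a sigma a (thead w) * t [tuple of a :: behead w]].

Lemma twist_first_pure sigma m (u : 'rV[k]_n) (us : m.-tuple 'rV[k]_n) :
  twist_first sigma (pure_tensor [tuple of u :: us]) =
  pure_tensor [tuple of (u *m sigma) :: us].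
Proof.
apply/ffunP => w; case/tupleP: w => i w; rewrite !ffunE.
rewrite big_ord_recl mxE mulr_suml; apply: eq_bigr => a _.
rewrite !ffunE big_ord_recl !tnth0 theadE mulrA [sigma a i * _]mulrC.
congr (_ * _); apply: eq_bigr => j _; rewrite !tnthS.
by congr (_ 0 _); rewrite !(tnth_nth i).
Qed.

Definition permute m (s : 'S_m) (t : tensor m) : tensor m :=
  [ffun w : m.-tuple 'I_n => t [tuple tnth w (s i) | i < m]].

Definition superpotential (t : tensor 3) := cyclic_shift t = t.

Definition twisted_superpotential (t : tensor 3) :=
  exists2 sigma : 'M[k]_n, sigma \in unitmx &
    twist_first sigma (cyclic_shift t) = t.

Definition symmetric_tensor m (t : tensor m) :=
  forall s : 'S_m, permute s t = t.

Definition derivation_quotient (t : tensor 3) : kalgebra k :=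
  quot_algebra (fun x : tensor_alg => exists i, x = tens (derivative i t)).

Definition derivation_proj (t : tensor 3) (x : tensor_alg) :
  derivation_quotient t := quot_proj _ x.

Definition derivation_piece (t : tensor 3) (m : nat)
    (x : derivation_quotient t) :=
  exists u : tensor m, x = derivation_proj t (tens u).

Definition regular_potential (t : tensor 3) :=
  quantum_polynomial 3 (@derivation_piece t).

(* R^perp, in the dual basis of V^*. *)
Definition orthogonal m (R : tensor m -> Prop) (s : tensor m) :=
  forall r, R r -> \sum_w s w * r w = 0.

Definition quadratic_algebra (R : tensor 2 -> Prop) : kalgebra k :=
  quot_algebra (fun x : tensor_alg => exists2 r, R r & x = tens r).

Definition quadratic_dual (R : tensor 2 -> Prop) : kalgebra k :=
  quadratic_algebra (orthogonal R).

(* S / (f), for S the derivation-quotient algebra of t. *)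
Definition conic (t : tensor 3) (f : derivation_quotient t) : kalgebra k :=
  quot_algebra (fun x => x = f).

Definition conic_proj (t : tensor 3) (f : derivation_quotient t)
  (x : tensor_alg) : conic f := quot_proj _ (derivation_proj t x).

(* The R such that S / (f) = T(V) / (R), see [conic_quadratic]. *)
Definition conic_relations (t : tensor 3) (f : derivation_quotient t)
  (r : tensor 2) := conic_proj f (tens r) = 0.

Lemma conic_quadratic (t : tensor 3) (f : derivation_quotient t)
    (x : tensor_alg) : derivation_piece 2 f ->
  conic_proj f x = 0 <->
  x \in gen_ideal (fun y : tensor_alg =>
    exists2 r, conic_relations f r & y = tens r).
Proof.
case=> u fE; set J := gen_ideal _.
have JD y z : y - z \in J -> z \in J -> y \in J.
  by move=> hyz hz; rewrite -[y](subrK z) rpredD.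
have kerJ y z : derivation_proj t y = derivation_proj t z -> z \in J -> y \in J.
  move=> /quot_projP /gen_idealP hyz; apply: JD.
  apply: (hyz (fun z => z \in J)) => [|_ [i ->]].
    split=> [|a b|a b c]; [exact: rpred0|exact: rpredB|exact: gen_idealM].
  apply: gen_ideal_gen; exists (derivative i t) => //.
  rewrite /conic_relations /conic_proj.
  suff -> : derivation_proj t (tens (derivative i t)) = 0 by exact: raddf0.
  by apply/quot_proj_eq0/gen_ideal_gen; exists i.
split=> [/quot_proj_eq0 /gen_idealP hx|/gen_idealP hx].
  apply: (hx (fun y => forall z, derivation_proj t z = y -> z \in J)) => //.
    split=> [z hz|y y' hy hy' z hz|a y b hy z hz].
    - by apply: (kerJ _ 0); rewrite ?rpred0 // hz; apply/esym/raddf0.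
    - apply: (kerJ _ (repr y - repr y')).
        by rewrite hz /derivation_proj raddfB /= !quot_proj_repr.
      by apply: rpredB; [apply: hy|apply: hy'];
        rewrite /derivation_proj quot_proj_repr.
    apply: (kerJ _ (repr a * repr y * repr b)).
      by rewrite hz /derivation_proj !quot_projM !quot_proj_repr.
    by apply: gen_idealM; apply: hy; rewrite /derivation_proj quot_proj_repr.
  move=> _ -> z hz; apply: (kerJ _ (tens u)); first by rewrite hz.
  apply: gen_ideal_gen; exists u => //.
  rewrite /conic_relations /conic_proj -fE.
  exact/quot_proj_eq0/gen_ideal_gen.
apply: (hx (fun z => conic_proj f z = 0)) => [|_ [r hr ->] //].
rewrite /conic_proj /derivation_proj.
split=> [|a b ha hb|a b c hb].
- by rewrite !raddf0.
- by rewrite !raddfB /= ha hb subr0.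
by rewrite !quot_projM hb mulr0 mul0r.
Qed.

End Potentials.

(* Main.v *)
Require Import Defs.
From mathcomp Require Import all_boot all_order all_fingroup all_algebra.
From mathcomp Require Import boolp.
From mathcomp Require Import finmap ring.
From mathcomp.multinomials Require Import monalg.

Set Implicit Arguments.
Unset Strict Implicit.
Unset Printing Implicit Defensive.

Import GRing.Theory.
Local Open Scope ring_scope.

(** Let R be the space of quadratic relations of A = S/(f), spanned by the three
derivatives of omega and a lift u of f.  The commutators x_i x_j - x_j x_i
generate the commutator ideal of the tensor algebra of the dual space, and no
new elements of degree 2 appear in the ideal generated by R^perp; hence A^! is
commutative if and only if every commutator is orthogonal to R, that is, if and
only if R consists of symmetric tensors ([quadratic_dual_commP]).

If R is symmetric then the derivatives of omega are symmetric, so omega is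
invariant under exchanging its last two factors.  Since sigma is invertible,
the twist equation turns this into invariance under exchanging the outer
factors, and the two transpositions generate the symmetric group
([twisted_symmetric]).

Conversely, let omega be symmetric; it must be shown that u is symmetric.  Write
R0 for the span of the derivatives, which is contained in Sym^2 V, and let
a = u - u^T be twice the alternating part of u.  Centrality of f gives
u x - x u in R0 V + V R0 for x in V ([quadric_ideal_cubic]).  Adding to this
its image under reversal of the three factors, a x - x a = P + P' where P lies
in V R0 and P' is its reversal.  The cyclic sum of the left-hand side vanishes,
hence so does that of P, 2 being invertible; solving for P shows that R0
contains the symmetric product of x with every contraction of a.  If a is
nonzero, its contractions span a plane U, and V U has dimension 5, while R0 has
dimension at most 3 ([symmetric_products_span], [central_symmetric]). *)

(** * Coefficients in the tensor algebra *)

Section Coefficients.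
Variables (k : fieldType) (n : nat).
Local Notation TA := (tensor_alg k n).

(** The coefficient of the word [s] in [x]. *)
Definition coef (x : TA) (s : seq 'I_n) : k := mcoeff (FMonom s) x.

Lemma coef_ext (x y : TA) : coef x =1 coef y -> x = y.
Proof. by move=> h; apply/malgP => w; have := h w; rewrite /coef fmK. Qed.

Lemma coefB (x y : TA) s : coef (x - y) s = coef x s - coef y s.
Proof. exact: mcoeffB. Qed.

Lemma coef0 s : coef 0 s = 0.
Proof. exact: mcoeff0. Qed.

Lemma coef_word (a : k) (v s : seq 'I_n) :
  coef << a *g FMonom v >> s = a *+ (v == s).
Proof. by rewrite /coef mcoeffU fmP. Qed.

Lemma coefM (x y : TA) s :
  coef (x * y) s =
  \sum_(i < (size s).+1) coef x (take i s) * coef y (drop i s).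
Proof.
have coefE (z : TA) v : coef z v =
    \sum_(w <- msupp z) z@_w *+ (w == FMonom v).
  rewrite /coef {1}[z]monalgE raddf_sum; apply: eq_bigr => w _.
  by rewrite /= mcoeffU.
rewrite /coef mcoeffMl -/(coef _ _).
under [RHS]eq_bigr => i _.
  rewrite -![mcoeff (FMonom _) _]/(coef _ _) 2!coefE mulr_suml; over.
rewrite [RHS]exchange_big; apply: eq_bigr => v _ /=.
under [RHS]eq_bigr => i _ do rewrite mulr_sumr.
rewrite [RHS]exchange_big; apply: eq_bigr => w _ /=.
under [RHS]eq_bigr => i _ do rewrite mulrnAl mulrnAr -mulrnA mulnb.
rewrite sumrMnr; congr (_ *+ _); rewrite fmP fmM /=.
(* A word factors as [v ++ w] in exactly one place, after [size v] letters. *)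
have cutE (i : 'I_(size s).+1) :
    (w == FMonom (drop i s)) && (v == FMonom (take i s)) =
    (i == size v :> nat) && (v ++ w == s :> seq _).
  rewrite !fmP /=; have := ltn_ord i; rewrite ltnS => le_is.
  apply/andP/andP => [[/eqP -> /eqP ->]|[/eqP -> /eqP <-]].
    by rewrite size_takel // cat_take_drop !eqxx.
  by rewrite drop_size_cat // take_size_cat // !eqxx.
under eq_bigr => i _ do rewrite cutE.
have [<-|_] := eqVneq; last by rewrite big1 // => i _; rewrite andbF.
have lt_v : (size v < (size (v ++ w)).+1)%N by rewrite size_cat ltnS leq_addr.
rewrite (bigD1 (Ordinal lt_v)) //= eqxx big1 // => i; rewrite andbT.
by rewrite -val_eqE /= => /negbTE ->.
Qed.

Lemma coefM0 (x y : TA) : coef (x * y) [::] = coef x [::] * coef y [::].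
Proof. by rewrite coefM big_ord_recr big_ord0 /= add0r. Qed.

Lemma coefM1 (x y : TA) i : coef (x * y) [:: i] =
  coef x [::] * coef y [:: i] + coef x [:: i] * coef y [::].
Proof. by rewrite coefM !big_ord_recr big_ord0 /= add0r. Qed.

Lemma coefM2 (x y : TA) i j : coef (x * y) [:: i; j] =
  coef x [::] * coef y [:: i; j] + coef x [:: i] * coef y [:: j]
  + coef x [:: i; j] * coef y [::].
Proof. by rewrite coefM !big_ord_recr big_ord0 /= add0r. Qed.

Lemma coefM3 (x y : TA) i j l : coef (x * y) [:: i; j; l] =
  coef x [::] * coef y [:: i; j; l] + coef x [:: i] * coef y [:: j; l]
  + coef x [:: i; j] * coef y [:: l] + coef x [:: i; j; l] * coef y [::].
Proof. by rewrite coefM !big_ord_recr big_ord0 /= add0r. Qed.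

Lemma coef_tens m (t : tensor k n m) (w : m.-tuple 'I_n) :
  coef (tens t) w = t w.
Proof.
rewrite /coef raddf_sum (bigD1 w) //= mcoeffUU big1 ?addr0 // => v.
by rewrite mcoeffU fmP /= val_eqE => /negbTE ->.
Qed.

Lemma coef_tens_neq m (t : tensor k n m) s : size s != m -> coef (tens t) s = 0.
Proof.
move=> sz_s; rewrite /coef raddf_sum big1 // => v _.
rewrite /= mcoeffU fmP /=; case: eqP => // vs.
by rewrite -vs size_tuple eqxx in sz_s.
Qed.

(** The generator [x_i] of the tensor algebra. *)
Definition letter (i : 'I_n) : TA := << FMonom [:: i] >>.

Lemma word_cons i s : (<< FMonom (i :: s) >> : TA) = letter i * << FMonom s >>.
Proof.
rewrite /letter malgM_def fgmulUU mulr1; congr << _ *g _ >>.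
by apply/eqP; rewrite fmP fmM.
Qed.

Lemma coef_letterM i j s : coef (letter i * letter j) s = ([:: i; j] == s)%:R.
Proof. by rewrite -(word_cons i [:: j]) coef_word. Qed.

End Coefficients.

(** * Ideals with prescribed components in degrees two and three *)

Section LowDegreeIdeal.
Variables (k : fieldType) (n : nat).
Local Notation TA := (tensor_alg k n).
Local Notation I := 'I_n.

(** Linear subspaces of the second and third tensor powers, elements of which
are given by their coordinate functions. *)
Definition linear_in2 (L : (I -> I -> k) -> Prop) :=
  L (fun _ _ => 0) /\
  forall a g g', L g -> L g' -> L (fun i j => a * g i j + g' i j).

Definition linear_in3 (C : (I -> I -> I -> k) -> Prop) :=
  C (fun _ _ _ => 0) /\
  forall a g g', C g -> C g' -> C (fun i j l => a * g i j l + g' i j l).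

Variables (L : (I -> I -> k) -> Prop) (C : (I -> I -> I -> k) -> Prop).

(** The elements without terms of degree 0 and 1 whose homogeneous components
of degree 2 and 3 lie in [L] and [C]. *)
Definition low_degree_ideal (x : TA) :=
  [/\ coef x [::] = 0, forall i, coef x [:: i] = 0,
      L (fun i j => coef x [:: i; j]) & C (fun i j l => coef x [:: i; j; l])].

Hypotheses (linL : linear_in2 L) (linC : linear_in3 C).
Hypothesis mulLC : forall (c : I -> k) g, L g -> C (fun i j l => c i * g j l).
Hypothesis mulCL : forall (c : I -> k) g, L g -> C (fun i j l => c l * g i j).

(** For linear [L] and [C], this is an ideal as soon as [C] contains V L and
L V: the components of [a * x * b] of degree at most 3 involve nothing else. *)
Lemma low_degree_idealP : two_sided_ideal low_degree_ideal.
Proof.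
case: linL linC => L0 LD [C0 CD].
split=> [|x y [x0 x1 xL xC] [y0 y1 yL yC]|a x b [x0 x1 xL xC]].
- split=> [|i||]; rewrite ?coef0 //.
    by under eq_fun => i do under eq_fun => j do rewrite coef0.
  under eq_fun => i do under eq_fun => j do under eq_fun => l do
    rewrite coef0.
  exact: C0.
- split=> [|i||]; rewrite ?coefB ?x0 ?x1 ?y0 ?y1 ?subrr //.
    under eq_fun => i do under eq_fun => j do rewrite coefB addrC -mulN1r.
    exact: LD.
  under eq_fun => i do under eq_fun => j do under eq_fun => l do
    rewrite coefB addrC -mulN1r.
  exact: CD.
have coefME := (coefM0, coefM1, coefM2, coefM3, x0, x1).
split=> [|i||].
- by rewrite !coefME; ring.
- by rewrite !coefME; ring.
- have e i j : coef (a * x * b) [:: i; j] =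
      coef a [::] * coef b [::] * coef x [:: i; j] + 0.
    by rewrite !coefME; ring.
  under eq_fun => i do under eq_fun => j do rewrite e.
  exact: (LD _ _ (fun _ _ => 0)).
have e i j l : coef (a * x * b) [:: i; j; l] =
    coef a [::] * coef b [::] * coef x [:: i; j; l] +
    (1 * (coef a [:: i] * coef b [::] * coef x [:: j; l]) +
    coef a [::] * coef b [:: l] * coef x [:: i; j]).
  by rewrite !coefME; ring.
under eq_fun => i do under eq_fun => j do under eq_fun => l do rewrite e.
apply: (CD _ _ (fun i j l => 1 * _ + _)) => //.
apply: (CD _ (fun i j l => _ * coef x [:: j; l])
  (fun i j l => _ * coef x [:: i; j])).
  exact: (mulLC (fun i => coef a [:: i] * coef b [::]) xL).
exact: (mulCL (fun l => coef a [::] * coef b [:: l]) xL).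
Qed.

End LowDegreeIdeal.

(** * Commutativity of the quadratic dual *)

Section QuadraticDual.
Variables (k : fieldType) (n : nat).
Local Notation TA := (tensor_alg k n).

Lemma comm_rmorphism (Q : pzRingType) (p : {rmorphism TA -> Q}) :
  (forall i j : 'I_n, GRing.comm (p (letter k i)) (p (letter k j))) ->
  forall x y : TA, GRing.comm (p x) (p y).
Proof.
move=> letterC; have pM x y : p (x * y) = p x * p y by apply: rmorphM.
have word_comm (z : Q) s : (forall i, GRing.comm z (p (letter k i))) ->
    GRing.comm z (p << FMonom s >>).
  move=> zC; elim: s => [|i s IHs].
    have -> : << FMonom [::] >> = 1 :> TA by rewrite -fmoneE.
    by rewrite rmorph1; apply: commr1.
  by rewrite word_cons pM; apply: commrM.
have wordC s t : GRing.comm (p << FMonom s >>) (p << FMonom t >>).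
  by apply/word_comm => i; apply/commr_sym/word_comm.
have tensorC (z y : TA) :
    (forall s, GRing.comm (p z) (p << FMonom s >>)) -> GRing.comm (p z) (p y).
  move=> zC; rewrite [y]monalgE raddf_sum; apply: commr_sum => w _.
  have -> : << y@_w *g w >> = kalg_map TA y@_w * << w >> :> TA.
    by rewrite [RHS]malgM_def fgmulUU mulr1 mul1m.
  rewrite /= pM; apply: commrM; last by case: w => s; apply: zC.
  by rewrite /GRing.comm -!pM kalg_central.
by move=> x y; apply/tensorC => s; apply/commr_sym/tensorC.
Qed.

Lemma quot_tensor_comm (X : TA -> Prop) :
  (forall i j : 'I_n, letter k i * letter k j - letter k j * letter k i
     \in gen_ideal X) ->
  forall x y : quot_algebra X, x * y = y * x.
Proof.
move=> lettersX x y; rewrite -[x]quot_proj_repr -[y]quot_proj_repr.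
apply: (comm_rmorphism (p := quot_proj X)) => i j.
have /quot_projP e := lettersX i j.
exact: etrans (esym (quot_projM X _ _)) (etrans e (quot_projM X _ _)).
Qed.

(** The tensor [x_i (x) x_j - x_j (x) x_i]. *)
Definition commutator_tensor (i j : 'I_n) : tensor k n 2 :=
  [ffun w => (w == [tuple i; j])%:R - (w == [tuple j; i])%:R].

Lemma tens_commutator i j : tens (commutator_tensor i j) =
  letter k i * letter k j - letter k j * letter k i.
Proof.
apply: coef_ext => s.
have -> : coef (letter k i * letter k j - letter k j * letter k i) s =
    ([:: i; j] == s)%:R - ([:: j; i] == s)%:R.
  by rewrite coefB; congr (_ - _); apply: coef_letterM.
have [/eqP sz_s|sz_s] := boolP (size s == 2).
  rewrite -[s]/(val (Tuple (introT eqP sz_s))) coef_tens ffunE.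
  by congr (_%:R - _%:R); congr nat_of_bool; rewrite [LHS]eq_sym.
rewrite coef_tens_neq //; case: eqP => [e|_]; first by rewrite -e in sz_s.
by case: eqP => [e|_]; [rewrite -e in sz_s|rewrite subrr].
Qed.

Lemma commutator_orthogonal i j (r : tensor k n 2) :
  \sum_w commutator_tensor i j w * r w = r [tuple i; j] - r [tuple j; i].
Proof.
have delta (v : 2.-tuple 'I_n) : \sum_w (w == v)%:R * r w = r v.
  rewrite (bigD1 v) //= eqxx mul1r big1 ?addr0 // => w /negbTE ->.
  by rewrite mul0r.
rewrite -!delta -sumrB; apply: eq_bigr => w _.
by rewrite ffunE mulrBl.
Qed.

Lemma quadratic_dual_commP (R : tensor k n 2 -> Prop) :
  (forall x y : quadratic_dual R, x * y = y * x) <->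
  (forall r, R r -> forall i j, r [tuple i; j] = r [tuple j; i]).
Proof.
split=> [commR r Rr i j|symR].
  (* The ideal of elements starting in degree 2 with a component orthogonal to
     [r] contains every element of [orthogonal R]. *)
  pose L (g : 'I_n -> 'I_n -> k) :=
    \sum_(w : 2.-tuple 'I_n) g (tnth w 0) (tnth w 1) * r w = 0.
  have linL : linear_in2 L.
    split=> [|a g g' Lg Lg']; first by rewrite /L big1 // => w _; rewrite mul0r.
    rewrite /L; under eq_bigr => w _ do rewrite mulrDl -mulrA.
    by rewrite big_split -mulr_sumr /= Lg Lg' mulr0 addr0.
  have := low_degree_idealP (C := fun=> True) linL.
  move=> /(_ (conj I (fun _ _ _ _ _ => I))).
  move=> /(_ (fun _ _ _ => I) (fun _ _ _ => I)) idL.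
  pose X (x : TA) := exists2 t, Defs.orthogonal R t & x = tens t.
  have /quot_projP/gen_idealP/(_ _ idL) :
      quot_proj X (letter k i * letter k j) =
      quot_proj X (letter k j * letter k i).
    exact: etrans (quot_projM _ _ _)
      (etrans (commR _ _) (esym (quot_projM _ _ _))).
  have tens2E (t : tensor k n 2) (w : 2.-tuple 'I_n) :
      coef (tens t) [:: tnth w 0; tnth w 1] = t w.
    by rewrite -coef_tens; case/tupleP: w => a w; case/tupleP: w => b w;
       rewrite tuple0.
  rewrite -tens_commutator => -[|_ _ + _]; last first.
  - rewrite /L; under eq_bigr => w _ do rewrite tens2E.
    by rewrite commutator_orthogonal => /eqP; rewrite subr_eq0 => /eqP.
  move=> _ [t orth_t ->]; split=> // [|i'|]; rewrite ?coef_tens_neq //.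
  by rewrite /L; under eq_bigr => w _ do rewrite tens2E; exact: orth_t.
apply: quot_tensor_comm => i j; apply: gen_ideal_gen.
exists (commutator_tensor i j); last by rewrite tens_commutator.
by move=> r Rr; rewrite commutator_orthogonal (symR _ Rr) subrr.
Qed.

End QuadraticDual.

(** * Symmetric tensors of degree three *)

Section SymmetricTensor.
Variables (k : fieldType) (n : nat).

Lemma symmetric_tensor3P (t : tensor k n 3) : symmetric_tensor t <->
  (forall i j l, t [tuple i; j; l] = t [tuple j; i; l]) /\
  (forall i j l, t [tuple i; j; l] = t [tuple i; l; j]).
Proof.
split=> [symt|[sym12 sym23]].
  have symt_s (s : 'S_3) (w w' : 3.-tuple 'I_n) :
      (forall i, tnth w' i = tnth w (s i)) -> t w = t w'.
    move=> ww'; rewrite -{1}(symt s) ffunE; congr (t _).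
    by apply: eq_from_tnth => i; rewrite tnth_mktuple ww'.
  split=> i j l.
    by apply: (symt_s (tperm 0 1)) => -[[|[|[|//]]] ?];
      rewrite permE !(tnth_nth i).
  by apply: (symt_s (tperm 1 2)) => -[[|[|[|//]]] ?];
    rewrite permE !(tnth_nth i).
move=> s; apply/ffunP => w; rewrite ffunE.
have [i [j [l ->]]] : exists i j l, w = [tuple i; j; l].
  case/tupleP: w => i w; case/tupleP: w => j w; case/tupleP: w => l w.
  by exists i, j, l; rewrite (tuple0 w); apply: val_inj.
set w' := mktuple _.
have -> : w' = [tuple tnth [tuple i; j; l] (s 0); tnth [tuple i; j; l] (s 1);
                      tnth [tuple i; j; l] (s 2)].
  apply: eq_from_tnth => a; rewrite tnth_mktuple.
  by case: a => [[|[|[|//]]] ?]; rewrite [RHS](tnth_nth i) /=;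
    congr (tnth _ (s _)); apply: val_inj.
have n01 : s 0 != s 1 by rewrite (inj_eq perm_inj).
have n02 : s 0 != s 2 by rewrite (inj_eq perm_inj).
have n12 : s 1 != s 2 by rewrite (inj_eq perm_inj).
move: (s 0) (s 1) (s 2) n01 n02 n12.
move=> [[|[|[|//]]] ?] [[|[|[|//]]] ?] [[|[|[|//]]] ?] // _ _ _;
  rewrite !(tnth_nth i) /=.
- by rewrite sym23 sym12.
- by rewrite sym12 sym23.
by rewrite sym12 sym23 sym12.
Qed.

Lemma symmetric_superpotential (t : tensor k n 3) :
  symmetric_tensor t -> superpotential t.
Proof.
move=> /symmetric_tensor3P[sym12 sym23]; apply/ffunP => w; rewrite ffunE.
case/tupleP: w => i w; case/tupleP: w => j w; case/tupleP: w => l w.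
rewrite (tuple0 w); transitivity (t [tuple l; i; j]).
  by congr (t _); apply: val_inj.
by rewrite sym12 sym23; congr (t _); apply: val_inj.
Qed.

Lemma twisted_symmetric (t : tensor k n 3) : twisted_superpotential t ->
  (forall i j l, t [tuple i; j; l] = t [tuple i; l; j]) -> symmetric_tensor t.
Proof.
case=> sigma sigmaU twt sym23.
have twE i j l : \sum_a sigma a i * t [tuple l; a; j] = t [tuple i; j; l].
  rewrite -{2}twt ffunE theadE; apply: eq_bigr => a _; rewrite ffunE.
  by congr (_ * t _); apply: val_inj.
have sym13 a j l : t [tuple l; a; j] = t [tuple j; a; l].
  (* The row [v] is killed by the invertible [sigma]: by [twE], its image has
     entries [t [tuple i; j; l] - t [tuple i; l; j]]. *)
  pose v := \row_b (t [tuple l; b; j] - t [tuple j; b; l]).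
  suff /rowP/(_ a) : v = 0 by rewrite !mxE => /eqP; rewrite subr_eq0 => /eqP.
  rewrite -[v](mulmxK sigmaU) (_ : v *m sigma = 0) ?mul0mx //.
  apply/rowP => i; rewrite !mxE.
  under eq_bigr => b _ do rewrite mxE mulrC mulrBr.
  by rewrite sumrB !twE sym23 subrr.
apply/symmetric_tensor3P; split=> // i j l.
by rewrite sym23 sym13 sym23.
Qed.

End SymmetricTensor.

(** * Symmetric products with an alternating form *)

(** The left-hand sides are the coordinates of the symmetric product of e_m and
the contraction [a j].  For [a] nonzero, four of them are linearly independent,
so that three elements cannot span them all. *)
Lemma symmetric_products_span (k : fieldType) (a : 'I_3 -> 'I_3 -> k)
    (M : 'I_3 -> 'I_3 -> 'I_3 -> k) :
  2%:R != 0 :> k -> (forall i j, a i j = - a j i) ->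
  (forall m j, exists c : 'I_3 -> k, forall i l,
     a j l * (i == m)%:R + a j i * (l == m)%:R = \sum_s c s * M s i l) ->
  forall p q, a p q = 0.
Proof.
move=> two_neq0 alt_a spanM p q; apply/eqP/negPn/negP => apq_neq0.
have a_diag i : a i i = 0.
  apply/eqP; have /eqP := alt_a i i; rewrite -addr_eq0 -mulr2n -mulr_natl.
  by rewrite mulf_eq0 (negbTE two_neq0).
have neq_pq : p != q by apply: contraNneq apq_neq0 => ->; rewrite a_diag.
have aqp_neq0 : a q p != 0 by rewrite alt_a oppr_eq0.
have [r neq_rp neq_rq] : exists2 r, r != p & r != q.
  have /subsetPn[r _] : ~~ ([set: 'I_3] \subset [set p; q]).
    by apply/negP => /subset_leq_card; rewrite cards2 cardsT card_ord neq_pq.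
  by rewrite !inE negb_or => /andP[]; exists r.
(* The products e_r a_q, e_q a_q, e_p a_q, e_q a_p, evaluated at the entries
   (p, r), (p, q), (p, p), (q, q), form a lower triangular matrix with the
   diagonal a_qp, a_qp, 2 a_qp, 2 a_pq. *)
pose m (s : 'I_4) := tnth [tuple r; q; p; q] s.
pose j (s : 'I_4) := tnth [tuple q; q; q; p] s.
pose i (s : 'I_4) := tnth [tuple p; p; p; q] s.
pose l (s : 'I_4) := tnth [tuple r; q; p; q] s.
pose W := \matrix_(s < 4, t < 4) (a (j s) (l t) * (i t == m s)%:R +
                                  a (j s) (i t) * (l t == m s)%:R).
have rankW : (\rank W <= 3)%N.
  have [c cE] := choice (fun s => spanM (m s) (j s)).
  have -> : W = (\matrix_(s < 4, u < 3) c s u) *m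
                (\matrix_(u < 3, t < 4) M u (i t) (l t)).
    apply/matrixP => s t; rewrite !mxE cE.
    by apply: eq_bigr => u _; rewrite !mxE.
  exact: leq_trans (mulmx_max_rank _ _).
have trigW : is_trig_mx W.
  apply/is_trig_mxP => s t; rewrite mxE /m /j /i /l.
  case: s t => [[|[|[|[|//]]]] ?] [[|[|[|[|//]]]] ?] //= _;
    rewrite !(tnth_nth p) /=.
  all: rewrite ?a_diag ?mul0r ?addr0 ?add0r //.
  all: try by rewrite ?(eq_sym p r) ?(eq_sym q r) ?(negbTE neq_rp)
    ?(negbTE neq_rq) ?(negbTE neq_pq) !mulr0 ?addr0.
have : W \in unitmx.
  rewrite unitmxE det_trig // unitfE; apply/prodf_neq0 => s _.
  rewrite mxE /m /j /i /l.
  case: s => [[|[|[|[|//]]]] ?] //=; rewrite !(tnth_nth p) /= !eqxx !mulr1.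
  - by rewrite (eq_sym p) (negbTE neq_rp) mulr0 add0r.
  - by rewrite (negbTE neq_pq) mulr0 add0r.
  - by rewrite -mulr2n -mulr_natl mulf_neq0.
  - by rewrite -mulr2n -mulr_natl mulf_neq0.
by rewrite -row_free_unit /row_free => /eqP rkW; rewrite rkW in rankW.
Qed.

(** * Central quadrics *)

(** For R the span of the [M l], the degree 3 component of the ideal generated
by R lies in V R + R V. *)
Lemma quadric_ideal_cubic (k : fieldType) n p (M : 'I_p -> tensor k n 2)
    (x : tensor_alg k n) :
  x \in gen_ideal (fun y => exists l, y = tens (M l)) ->
  exists c d : 'I_n -> 'I_p -> k, forall i j m, coef x [:: i; j; m] =
    \sum_l c i l * M l [tuple j; m] + \sum_l d m l * M l [tuple i; j].
Proof.
pose L (g : 'I_n -> 'I_n -> k) := exists c : 'I_p -> k,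
  forall i j, g i j = \sum_l c l * M l [tuple i; j].
pose C (g : 'I_n -> 'I_n -> 'I_n -> k) := exists c d : 'I_n -> 'I_p -> k,
  forall i j m, g i j m =
    \sum_l c i l * M l [tuple j; m] + \sum_l d m l * M l [tuple i; j].
have sum0 (w : 2.-tuple 'I_n) : \sum_l (0 : k) * M l w = 0.
  by rewrite big1 // => l _; rewrite mul0r.
have sumZ (e : k) (c : 'I_p -> k) w :
    \sum_l e * c l * M l w = e * \sum_l c l * M l w.
  by rewrite mulr_sumr; apply: eq_bigr => l _; rewrite mulrA.
have sumD (c c' : 'I_p -> k) (w : 2.-tuple 'I_n) :
    \sum_l (c l + c' l) * M l w = \sum_l c l * M l w + \sum_l c' l * M l w.
  by rewrite -big_split; apply: eq_bigr => l _; rewrite mulrDl.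
have linL : linear_in2 L.
  split=> [|e g g' [c gE] [c' gE']].
    by exists (fun=> 0) => i j; rewrite sum0.
  by exists (fun l => e * c l + c' l) => i j; rewrite gE gE' sumD sumZ.
have linC : linear_in3 C.
  split=> [|e g g' [c [d gE]] [c' [d' gE']]].
    by exists (fun _ _ => 0), (fun _ _ => 0) => i j m; rewrite !sum0 addr0.
  exists (fun i l => e * c i l + c' i l), (fun m l => e * d m l + d' m l).
  by move=> i j m; rewrite gE gE' !sumD !sumZ; ring.
have idJ : two_sided_ideal (low_degree_ideal L C).
  apply: low_degree_idealP => // e g [c gE].
    exists (fun i l => e i * c l), (fun _ _ => 0) => i j m.
    by rewrite gE sumZ sum0 addr0.
  exists (fun _ _ => 0), (fun m l => e m * c l) => i j m.
  by rewrite gE sumZ sum0 add0r.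
move/gen_idealP/(_ _ idJ) => -[|_ _ _ //] _ [l ->].
split=> [|i||]; rewrite ?coef_tens_neq //.
  exists (fun l' => (l' == l)%:R) => i j.
  rewrite (coef_tens _ [tuple i; j]) (bigD1 l) //= (eqxx l) mul1r.
  rewrite big1 ?addr0 //.
  by move=> l' /negbTE ->; rewrite mul0r.
exists (fun _ _ => 0), (fun _ _ => 0) => i j m.
by rewrite !sum0 addr0 coef_tens_neq.
Qed.

Lemma coef_letter (k : fieldType) n (i : 'I_n) s :
  coef (letter k i) s = ([:: i] == s)%:R.
Proof. exact: coef_word. Qed.

Lemma tens_letter (k : fieldType) n (u : tensor k n 2) m i j l :
  coef (tens u * letter k m) [:: i; j; l] = u [tuple i; j] * (l == m)%:R.
Proof.
rewrite coefM3 !coef_letter [coef _ [::]]coef_tens_neq //.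
rewrite [coef _ [:: i]]coef_tens_neq // mulr0 addr0 !mul0r !add0r.
by rewrite (coef_tens u [tuple i; j]) eqseq_cons andbT (eq_sym m).
Qed.

Lemma letter_tens (k : fieldType) n (u : tensor k n 2) m i j l :
  coef (letter k m * tens u) [:: i; j; l] = u [tuple j; l] * (i == m)%:R.
Proof.
rewrite coefM3 !coef_letter [coef _ [::]]coef_tens_neq //.
rewrite [coef _ [:: l]]coef_tens_neq // !mulr0 !addr0 mul0r add0r.
by rewrite (coef_tens u [tuple j; l]) eqseq_cons andbT (eq_sym m) mulrC.
Qed.

Section Conic.
Variables (k : fieldType) (omega : tensor k 3 3) (u : tensor k 3 2).
Hypothesis omega_sym : symmetric_tensor omega.
Let f : derivation_quotient omega := derivation_proj omega (tens u).

Lemma central_symmetric : 2%:R != 0 :> k ->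
  (forall s : derivation_quotient omega, f * s = s * f) ->
  forall i j, u [tuple i; j] = u [tuple j; i].
Proof.
move=> two_neq0 f_central.
have [_ sym23] := (symmetric_tensor3P _).1 omega_sym.
pose M (s i j : 'I_3) := omega [tuple s; i; j].
have symM s i j : M s i j = M s j i by apply: sym23.
have derE s i j : derivative s omega [tuple i; j] = M s i j.
  by rewrite ffunE; congr (omega _); apply: val_inj.
pose a i j := u [tuple i; j] - u [tuple j; i].
have alt_a i j : a i j = - a j i by rewrite /a opprB.
suff a0 i j : a i j = 0.
  by move=> i j; apply/eqP; rewrite -subr_eq0 -/(a i j) a0.
apply: (symmetric_products_span (M := M)) => // {i j} m j.
have /quot_projP/quadric_ideal_cubic[c [d cdE]] :
    derivation_proj omega (tens u * letter k m) =
    derivation_proj omega (letter k m * tens u).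
  exact: etrans (quot_projM _ _ _)
    (etrans (f_central _) (esym (quot_projM _ _ _))).
have cubicE i j' l : u [tuple i; j'] * (l == m)%:R
    - u [tuple j'; l] * (i == m)%:R =
    \sum_s c i s * M s j' l + \sum_s d l s * M s i j'.
  have := cdE i j' l; rewrite coefB tens_letter letter_tens => ->.
  by congr (_ + _); apply: eq_bigr => s _; rewrite derE.
pose P i j l := \sum_s c i s * M s j l + \sum_s d i s * M s j l.
have sum_symM (e : 'I_3 -> k) i j' :
    \sum_s e s * M s i j' = \sum_s e s * M s j' i.
  by apply: eq_bigr => s _; rewrite symM.
have symP i j' l : P i j' l = P i l j'.
  by rewrite /P ![\sum_s _ * M s l _]sum_symM.
(* [P l i j'] stands for its equal [P l j' i], the reversal of [P]. *)
have PE i j' l :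
    a i j' * (l == m)%:R - a j' l * (i == m)%:R = P i j' l + P l i j'.
  transitivity (u [tuple i; j'] * (l == m)%:R - u [tuple j'; l] * (i == m)%:R
    + (u [tuple l; j'] * (i == m)%:R - u [tuple j'; i] * (l == m)%:R)).
    by rewrite /a; ring.
  by rewrite !cubicE /P (sum_symM (c l) j') (sum_symM (d i) l); ring.
(* Summed over the cyclic permutations of (i, j', l), the left-hand sides of
   [PE] cancel. *)
have cycP i j' l : P i j' l + P j' l i + P l i j' = 0.
  apply: (mulfI two_neq0); rewrite mulr0.
  transitivity ((P i j' l + P l i j') + (P j' l i + P i j' l)
    + (P l i j' + P j' l i)); first by ring.
  by rewrite -!PE; ring.
exists (fun s => c j s + d j s) => i l.
transitivity (P j i l); last first.
  by rewrite /P -big_split; apply: eq_bigr => s _; rewrite mulrDl.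
have := PE i j l; have /eqP := cycP i j l.
rewrite addrAC addr_eq0 => /eqP -> /eqP; rewrite symP -eqr_oppLR => /eqP <-.
by rewrite (alt_a i j); ring.
Qed.

Lemma conic_relations_symmetric :
  (forall i j, u [tuple i; j] = u [tuple j; i]) ->
  forall r, conic_relations f r -> forall i j, r [tuple i; j] = r [tuple j; i].
Proof.
move=> u_sym r /quot_proj_eq0/gen_idealP f_r.
have [_ sym23] := (symmetric_tensor3P _).1 omega_sym.
pose sym_form (g : 'I_3 -> 'I_3 -> k) := forall i j, g i j = g j i.
(* [J] is an ideal of the tensor algebra containing the relations of the
   derivation-quotient algebra, and its image [JA] there contains [f]. *)
pose J := low_degree_ideal sym_form (fun=> True).
have idJ : two_sided_ideal J.
  apply: low_degree_idealP => //; split=> // e g g' sg sg' i j.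
  by rewrite sg sg'.
have tensJ (t : tensor k 3 2) :
    J (tens t) <-> forall i j, t [tuple i; j] = t [tuple j; i].
  have tE i j : coef (tens t) [:: i; j] = t [tuple i; j].
    exact: (coef_tens t [tuple i; j]).
  split=> [[_ _ symt _] i j|symt]; first by rewrite -!tE.
  by split=> [|i|i j|//]; rewrite ?tE // coef_tens_neq.
apply/tensJ.
have JS x :
    x \in gen_ideal (fun y => exists i, y = tens (derivative i omega)) -> J x.
  move=> /gen_idealP/(_ _ idJ); apply=> _ [i ->]; apply/tensJ => j l.
  rewrite !ffunE; transitivity (omega [tuple i; j; l]).
    by congr (omega _); apply: val_inj.
  by rewrite sym23; congr (omega _); apply: val_inj.
pose JA (s : derivation_quotient omega) :=
  exists2 x, J x & s = derivation_proj omega x.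
case: idJ => J0 JB JM.
have idJA : two_sided_ideal JA.
  split=> [|_ _ [x Jx ->] [y Jy ->]|a _ b [x Jx ->]].
  - by exists 0 => //; rewrite /derivation_proj raddf0.
  - by exists (x - y); [apply: JB|rewrite /derivation_proj raddfB].
  exists (generic_quotient.repr a * x * generic_quotient.repr b).
    exact: JM.
  by rewrite /derivation_proj !quot_projM !quot_proj_repr.
have [x Jx /quot_projP/JS Jrx] : JA (derivation_proj omega (tens r)).
  by apply: f_r => // _ ->; exists (tens u) => //; apply/tensJ.
have -> : tens r = tens r - x - (0 - x) by rewrite sub0r opprK subrK.
by apply: (JB) => //; apply: JB.
Qed.

End Conic.

(** * Conics with commutative quadratic dual *)

Theorem theorem3p7 (k : closedFieldType) (char0 : [pchar k] =i pred0)
    (omega : tensor k 3 3)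
    (omega_twisted : twisted_superpotential omega)
    (omega_regular : regular_potential omega)
    (f : derivation_quotient omega)
    (f_deg2 : derivation_piece 2 f)
    (f_central : forall s : derivation_quotient omega, f * s = s * f)
    (f_regular : injective (fun s : derivation_quotient omega => f * s) /\
                 injective (fun s : derivation_quotient omega => s * f)) :
  (forall x y : quadratic_dual (conic_relations f), x * y = y * x)
  <->
  [/\ symmetric_tensor omega, regular_potential omega & superpotential omega].
Proof.
have two_neq0 : 2%:R != 0 :> k by have /pcharf0P -> := char0.
rewrite quadratic_dual_commP; split=> [symR|[omega_sym _ _] r].
  suff omega_sym : symmetric_tensor omega.
    by split=> //; apply: symmetric_superpotential.
  apply: twisted_symmetric => // i j l.
  have : conic_relations f (derivative i omega).
    apply/quot_proj_eq0; rewrite (_ : derivation_proj _ _ = 0) ?rpred0 //.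
    by apply/quot_proj_eq0/gen_ideal_gen; exists i.
  move=> /symR/(_ j l); rewrite !ffunE.
  have tupleE a b :
      [tuple of i :: [tuple a; b]] = [tuple i; a; b] :> 3.-tuple _.
    exact: val_inj.
  by rewrite !tupleE.
case: f_deg2 => u fE; rewrite fE in f_central *.
exact/conic_relations_symmetric/central_symmetric.
Qed.
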